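(* For all integers $n,r\ge 1$, the big algebra $\mathscr{B}(\mathcal{P}(n,r))$ is commutative.
   Context: $\mathfrak{gl}_n$ (complex $n\times n$ matrices) has matrix units $E_{ij}$ and coordinates $y_{ij}$; $c_k(Y)$ is the sum of the principal $k\times k$ minors of $Y$ ($c_0=1$). $\mathcal{P}(n,r)=\mathbb{C}[\mathrm{Mat}(n,r)]=\mathbb{C}[x_{i\alpha}:1\le i\le n,1\le\alpha\le r]$, $\partial_{i\alpha}=\partial/\partial x_{i\alpha}$. $\mathrm{GL}_n$ acts on $\mathcal{P}(n,r)$ by $(gP)(A)=P(g^tA)$ and the corresponding $\mathfrak{gl}_n$-action is $L(E_{ij})=\sum_{\alpha=1}^r x_{i\alpha}\partial_{j\alpha}$. On $\mathrm{GL}_n$-equivariant polynomial maps $F:\mathfrak{gl}_n\to\mathrm{End}\,\mathcal{P}(n,r)$ (with pointwise multiplication) the Kirillov--Wei operator is $(\mathbf{D}F)(Y)=\sum_{i,j=1}^n\frac{\partial F}{\partial y_{ji}}(Y)\cdot L(E_{ij})$; $c_k$ is identified with $Y\mapsto c_k(Y)\,\mathrm{Id}$. The big algebra $\mathscr{B}(\mathcal{P}(n,r))$ is the subalgebra of the algebra of such maps generated by $M_{p,q}=\mathbf{D}^q(c_{p+q})$, $p,q\ge0$, $p+q\le n$. *)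

(* Defs.v *)
From HB Require Import structures.
From mathcomp Require Import all_boot all_order all_algebra.
From mathcomp Require Import boolp reals.
From mathcomp Require Import complex mpoly.

Set Implicit Arguments.
Unset Strict Implicit.
Unset Printing Implicit Defensive.

Import GRing.Theory.
Local Open Scope ring_scope.

(* The K-algebra End_K(V), with composition as product.  V is taken to be a
   (nonzero) K-algebra only to guarantee that 1 != 0 in End_K(V). *)
Definition endo (K : comNzRingType) (V : lalgType K) : Type :=
  {linear V -> V}.

Section Endo.
Variables (K : comNzRingType) (V : lalgType K).
Local Notation E := (endo V).
Implicit Types (f g h : E) (a b : K).

HB.instance Definition _ := gen_eqMixin E.
HB.instance Definition _ := gen_choiceMixin E.

Lemma endoP f g : f =1 g -> f = g.
Proof.
case: f g => [f [[fA] [fZ]]] [g [[gA] [gZ]]] /= /funext fg.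
move: fA fZ gA gZ; rewrite fg => fA fZ gA gZ.
by rewrite (Prop_irrelevance fA gA) (Prop_irrelevance fZ gZ).
Qed.

Definition endo_zero : E := \0.
Definition endo_opp f : E := \- f.
Definition endo_add f g : E := f \+ g.
Definition endo_scale a f : E := a \*: f.
Definition endo_one : E := idfun.
Definition endo_mul f g : E := f \o g.

Fact endo_addA : associative endo_add.
Proof. by move=> f g h; apply: endoP => v /=; rewrite addrA. Qed.
Fact endo_addC : commutative endo_add.
Proof. by move=> f g; apply: endoP => v /=; rewrite addrC. Qed.
Fact endo_add0 : left_id endo_zero endo_add.
Proof. by move=> f; apply: endoP => v /=; rewrite add0r. Qed.
Fact endo_addN : left_inverse endo_zero endo_opp endo_add.
Proof. by move=> f; apply: endoP => v /=; rewrite addNr. Qed.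
HB.instance Definition _ :=
  GRing.isZmodule.Build E endo_addA endo_addC endo_add0 endo_addN.

Fact endo_mulA : associative endo_mul.
Proof. by move=> f g h; apply: endoP. Qed.
Fact endo_mul1 : left_id endo_one endo_mul.
Proof. by move=> f; apply: endoP. Qed.
Fact endo_mulr1 : right_id endo_one endo_mul.
Proof. by move=> f; apply: endoP. Qed.
Fact endo_mulDl : left_distributive endo_mul +%R.
Proof. by move=> f g h; apply: endoP. Qed.
Fact endo_mulDr : right_distributive endo_mul +%R.
Proof. by move=> f g h; apply: endoP => v /=; rewrite raddfD. Qed.
Fact endo_one_neq0 : endo_one != 0.
Proof.
by apply/eqP => /(congr1 (fun f : E => f 1)) /= /eqP; rewrite oner_eq0.
Qed.
HB.instance Definition _ := GRing.Zmodule_isNzRing.Build E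
  endo_mulA endo_mul1 endo_mulr1 endo_mulDl endo_mulDr endo_one_neq0.

Fact endo_scaleA a b f :
  endo_scale a (endo_scale b f) = endo_scale (a * b) f.
Proof. by apply: endoP => v /=; rewrite scalerA. Qed.
Fact endo_scale1 : left_id 1 endo_scale.
Proof. by move=> f; apply: endoP => v /=; rewrite scale1r. Qed.
Fact endo_scaleDr : right_distributive endo_scale +%R.
Proof. by move=> a f g; apply: endoP => v /=; rewrite scalerDr. Qed.
Fact endo_scaleDl f : {morph endo_scale^~ f : a b / a + b}.
Proof. by move=> a b; apply: endoP => v /=; rewrite scalerDl. Qed.
HB.instance Definition _ := GRing.Zmodule_isLmodule.Build K E
  endo_scaleA endo_scale1 endo_scaleDr endo_scaleDl.

Fact endo_scaleAl a f g : a *: (f * g) = (a *: f) * g.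
Proof. by apply: endoP. Qed.
HB.instance Definition _ := GRing.Lmodule_isLalgebra.Build K E endo_scaleAl.
Fact endo_scaleAr a f g : a *: (f * g) = f * (a *: g).
Proof. by apply: endoP => v /=; rewrite linearZ. Qed.
HB.instance Definition _ := GRing.Lalgebra_isAlgebra.Build K E endo_scaleAr.

End Endo.

Section BigAlgebra.
Variables (C : comNzRingType) (n r : nat).

(* C[Mat(n, r)] *)
Definition polyMat := {mpoly C[n * r]}.
HB.instance Definition _ := GRing.ComAlgebra.on polyMat.

Definition xvar (i : 'I_n) (al : 'I_r) : polyMat := 'X_(mxvec_index i al).
Definition dvar (i : 'I_n) (al : 'I_r) (P : polyMat) : polyMat :=
  P^`M(mxvec_index i al).

Definition gl_fun (i j : 'I_n) (P : polyMat) : polyMat :=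
  \sum_(al < r) xvar i al * dvar j al P.

Fact gl_fun_is_linear i j : linear (gl_fun i j).
Proof.
move=> a P Q; rewrite /gl_fun scaler_sumr -big_split /=.
apply: eq_bigr => al _.
by rewrite /dvar linearP mulrDr -scalerAr.
Qed.
HB.instance Definition _ i j :=
  GRing.isLinear.Build C polyMat polyMat *:%R (gl_fun i j)
    (gl_fun_is_linear i j).

(* The operator L(E_ij). *)
Definition glL (i j : 'I_n) : endo polyMat := gl_fun i j.

(* Polynomial maps gl_n -> End P(n,r), written as polynomials in the
   coordinates y_ij with coefficients in End P(n,r).  When C is an infinite
   field such a polynomial is determined by the map it defines. *)
Definition polymap := {mpoly (endo polyMat)[n * n]}.

Definition polymap_eval (F : polymap) (Y : 'M[C]_n) : endo polyMat :=
  mmap idfun (fun k => (mxvec Y 0 k)%:A) F.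

Definition generic_mx : 'M[{mpoly C[n * n]}]_n :=
  \matrix_(i, j) 'X_(mxvec_index i j).

Definition principal_minor (I : {set 'I_n}) : {mpoly C[n * n]} :=
  \det (mxsub (@enum_val _ (mem I)) (@enum_val _ (mem I)) generic_mx).

Definition cpoly (k : nat) : {mpoly C[n * n]} :=
  \sum_(I : {set 'I_n} | #|I| == k) principal_minor I.

Definition cmap (k : nat) : polymap :=
  map_mpoly (in_alg (endo polyMat)) (cpoly k).

Definition kirillov_wei (F : polymap) : polymap :=
  \sum_(i < n) \sum_(j < n) F^`M(mxvec_index j i) * (glL i j)%:MP.

Definition bigM (p q : nat) : polymap := iter q kirillov_wei (cmap (p + q)).

(* The subalgebra generated by the M_{p,q}, for the pointwise operations on
   maps.  The M_{p,q} are GL_n-equivariant and the subalgebra they generate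
   does not depend on the algebra in which it is formed, so equivariance does
   not appear explicitly. *)
Inductive big_algebra : ('M[C]_n -> endo polyMat) -> Prop :=
| BigGen p q : (p + q <= n)%N -> big_algebra (polymap_eval (bigM p q))
| BigOne : big_algebra (fun=> 1)
| BigAdd F G : big_algebra F -> big_algebra G -> big_algebra (F \+ G)
| BigScale a F : big_algebra F -> big_algebra (a \*: F)
| BigMul F G : big_algebra F -> big_algebra G -> big_algebra (F \* G).

End BigAlgebra.

(* Main.v *)
(* Fix Y and let m be the matrix with entries m_ij = sum_a xi_ia x_ja, where
   xi_ia is the symbol of d/dx_ia; symbols are normally ordered (x to the left
   of the derivations).

   1. For h in C[gl_n], D applied to h (Y + t m) acts on symbols as
        h |-> d/dt h (Y + t m) - t d/dt (tr d h) (Y + t m)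
      provided d_il d_ji h = - d_jl d_ii h.  This antisymmetry holds for the
      c_k, and tr d c_k is a multiple of c_(k-1), so every M_{p,q} (Y) is a
      combination of the operators whose symbols are the t-coefficients of
      the c_k (Y + t m), i.e. the coefficients of det (u + Y + t m) in u and t.

   2. Put N = u + Y + s m and G = v + Y + t m.  Expanding both determinants,
      Wick's theorem allows at most one contraction for each index i, and the
      product of the operators with symbols det G and det N has symbol
        sum_(v, w) sgn v sgn w prod_i (N_(v i, i) G_(i, w i) + s t m_(v i, w i))
        = sum_q q! [z^q] det (N G + z s t m).
      This is symmetric in N and G: if s = t the two matrices commute, and
      otherwise, with d = z s t / (t - s), the matrices N G + z s t m and
      G N + z s t m differ by one and the same scalar from
      (N + d) (G - d) and (G - d) (N + d), while det (P Q + c) = det (Q P + c). *)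
Require Import Defs.
From HB Require Import structures.
From mathcomp Require Import all_boot all_order all_fingroup all_algebra.
From mathcomp Require Import boolp reals.
From mathcomp Require Import complex mpoly ring.

Set Implicit Arguments.
Unset Strict Implicit.
Unset Printing Implicit Defensive.

Import GRing.Theory.
Local Open Scope ring_scope.

Section Determinants.
Variable R : comNzRingType.

Lemma det_addMC (m n : nat) (U : 'M[R]_(m, n)) (V : 'M[R]_(n, m)) :
  \det (1%:M + U *m V) = \det (1%:M + V *m U).
Proof.
pose A := block_mx 1%:M (- U) V 1%:M.
pose B := block_mx 1%:M U 0 (1%:M : 'M[R]_n).
have AB : A *m B = block_mx 1%:M 0 V (1%:M + V *m U).
  by rewrite mulmx_block !mul1mx !mulmx1 !mulmx0 !addr0 subrr addrC.
have BA : B *m A = block_mx (1%:M + U *m V) 0 V 1%:M.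
  by rewrite mulmx_block !mul1mx !mulmx1 !mul0mx !add0r addNr.
have : \det (B *m A) = \det (A *m B) by rewrite !det_mulmx mulrC.
by rewrite AB BA !det_lblock !det1 mul1r mulr1.
Qed.

End Determinants.

Lemma det_mulmx_scalarC (R : comNzRingType) (n : nat) (P Q : 'M[R]_n) (c : R) :
  \det (P *m Q + c%:M) = \det (Q *m P + c%:M).
Proof.
pose e := map_mx (@polyC R); pose X : 'M[{poly R}]_n := 'X%:M.
have detX : \det (X + e n n P) \is monic.
  have -> : X + e n n P = char_poly_mx (- P).
    by rewrite /char_poly_mx map_mxN opprK.
  exact: char_poly_monic.
have : \det ((X + e n n P) *m e n n Q + (c%:P)%:M)
     = \det (e n n Q *m (X + e n n P) + (c%:P)%:M).
  apply: (monic_rreg detX); rewrite [RHS]mulrC -!det_mulmx; congr (\det _).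
  move: (X + _) => P'.
  by rewrite mulmxDl mulmxDr mulmxA scalar_mxC.
move=> /(congr1 (horner_eval 0)); rewrite -!det_map_mx.
have h0 (M : 'M[R]_n) : map_mx (horner_eval 0) (e n n M) = M.
  by apply/matrixP => i j; rewrite !mxE /horner_eval hornerC.
rewrite !map_mxD !map_mxM !map_mxD !h0 !map_scalar_mx /=.
by rewrite /horner_eval hornerX hornerC raddf0 !add0r.
Qed.

Lemma perm_extension (T : finType) (g : T -> T) (A : {set T}) :
  {in A &, injective g} -> exists s : {perm T}, {in A, s =1 g}.
Proof.
move=> ginj; suff [s sP] : exists s : {perm T}, {in enum A, s =1 g}.
  by exists s => x xA; apply: sP; rewrite mem_enum.
have : {subset enum A <= A} by move=> x; rewrite mem_enum.
elim: (enum A) (enum_uniq A) => [_ _|a l IH /=]; first by exists 1%g.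
case/andP=> al ul sub; have [|s sP] := IH ul.
  by move=> x xl; apply: sub; rewrite inE xl orbT.
exists (s * tperm (s a) (g a))%g => x; rewrite inE permM.
have [-> _|xa /= xl] := eqVneq x a; first by rewrite tpermL.
rewrite (sP x xl) tpermD //.
  by rewrite -(sP x xl) (inj_eq perm_inj) eq_sym.
apply: contra xa => /eqP gax; apply/eqP; symmetry; apply: ginj => //;
  by apply: sub; rewrite inE ?eqxx ?xl ?orbT.
Qed.

Lemma card_perm_extension (T : finType) (g : T -> T) (A : {set T}) :
  {in A &, injective g} ->
  #|[set s : {perm T} | [forall x in A, s x == g x]]| = (#|~: A|)`!.
Proof.
move=> /perm_extension[s0 s0P].
rewrite -card_perm -[RHS](card_imset _ (mulIg s0)); apply: eq_card => s.
rewrite inE; apply/forall_inP/imsetP => [sP|[u uA ->] x xA].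
  exists (s * s0^-1)%g; last by rewrite mulgKV.
  apply/subsetP => x; rewrite !inE permM; apply: contra => xA.
  by rewrite (eqP (sP x xA)) -(s0P x xA) permK.
by rewrite permM (out_perm uA) ?s0P // inE xA.
Qed.

Section Wick.
Variables (R : comNzRingType) (n : nat).
Implicit Types (N G M : 'M[R]_n) (phi : {ffun 'I_n -> option 'I_n}).

Definition wick N G M : R :=
  \sum_(v : 'S_n) \sum_(w : 'S_n) (-1) ^+ v * (-1) ^+ w *
    \prod_i (N (v i) i * G i (w i) + M (v i) (w i)).

Definition choice_det N G M phi : R :=
  \det (\matrix_(a, b) if phi a is Some i then N a i * G i b else M a b).

Let defined phi := [set a | phi a != None].

Lemma det_mulmxD_expand N G M :
  \det (map_mx polyC (N *m G) + 'X *: map_mx polyC M)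
  = \sum_phi (choice_det N G M phi)%:P * 'X^#|~: defined phi|.
Proof.
pose F a o b : {poly R} :=
  if o is Some i then (N a i * G i b)%:P else 'X * (M a b)%:P.
transitivity (\sum_(s : 'S_n) \sum_(phi : {ffun 'I_n -> option 'I_n})
    (-1) ^+ s * \prod_a F a (phi a) (s a)).
  apply: eq_bigr => s _; rewrite -big_distrr /=; congr (_ * _).
  rewrite -(bigA_distr_bigA (fun a o => F a o (s a))); apply: eq_bigr => a _.
  rewrite !mxE rmorph_sum /= [RHS](bigD1 None) //= addrC; congr (_ + _).
  rewrite (reindex_omap Some id) /=; last by case.
  by apply: eq_bigl => i; rewrite eqxx.
rewrite exchange_big; apply: eq_bigr => phi _ /=.
rewrite rmorph_sum /= mulr_suml; apply: eq_bigr => s _.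
rewrite rmorphM rmorph_sign -mulrA; congr (_ * _).
rewrite rmorph_prod /= (bigID (mem (~: defined phi))) [in RHS](bigID (mem (~: defined phi))) /=.
rewrite -prodr_const [RHS]mulrC mulrA -big_split /=; congr (_ * _).
  apply: eq_bigr => a; rewrite !inE negbK => /eqP.
  by rewrite /F !mxE => ->.
apply: eq_bigr => a; rewrite !inE negbK /F !mxE; by case: (phi a).
Qed.

Lemma choice_det_eq0 N G M phi i j :
  i != j -> phi i = phi j -> phi i != None -> choice_det N G M phi = 0.
Proof.
move=> ij eqij; case phi_i: (phi i) => [k|//] _.
pose A := \matrix_(a, b) if phi a is Some i then G i b else M a b.
have -> : choice_det N G M phi = (\prod_a (if phi a is Some k then N a k else 1)) * \det A.
  rewrite /choice_det /determinant mulr_sumr; apply: eq_bigr => s _.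
  rewrite mulrCA -big_split /=; congr (_ * _); apply: eq_bigr => a _.
  by rewrite !mxE; case: (phi a) => //; rewrite mul1r.
rewrite (determinant_alternate ij) ?mulr0 // => b.
by rewrite !mxE -eqij phi_i.
Qed.

Lemma wick_choice_det N G M :
  wick N G M = \sum_phi choice_det N G M phi *+ (#|~: defined phi|)`!.
Proof.
pose mk (p : 'S_n * {set 'I_n}) : {ffun 'I_n -> option 'I_n} :=
  [ffun a => if a \in p.2 then Some (p.1 a) else None].
transitivity (\sum_p choice_det N G M (mk p)).
  rewrite -(pair_bigA _ (fun f J => choice_det N G M (mk (f, J)))) /=.
  rewrite [RHS](reindex_inj invg_inj); apply: eq_bigr => v _.
  rewrite (reindex_inj (mulgI v)) exchange_big /=; apply: eq_bigr => s _.
  rewrite odd_permM signr_addb mulrA -signr_addb addbb mul1r -mulr_sumr.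
  congr (_ * _); rewrite (reindex_inj (@perm_inj _ v^-1)) /=.
  transitivity (\prod_a (N a (v^-1%g a) * G (v^-1%g a) (s a) + M a (s a))).
    by apply: eq_bigr => a _; rewrite permM permKV.
  rewrite bigA_distr; apply: eq_bigr => J _.
  by apply: eq_bigr => a _; rewrite mxE /mk ffunE /=; case: ifP.
rewrite (partition_big mk predT) //=; apply: eq_bigr => phi _.
rewrite (eq_bigr (fun=> choice_det N G M phi)) => [|p /eqP-> //].
rewrite sumr_const.
have [ginj|] := boolP [forall a in defined phi, forall b in defined phi,
    (phi a == phi b) ==> (a == b)].
  pose g a := odflt a (phi a).
  have gI : {in defined phi &, injective g}.
    move=> a b aD bD; rewrite /g => e; apply/eqP.
    apply: (implyP (forall_inP (forall_inP ginj a aD) b bD)).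
    by move: aD bD e; rewrite !inE; case: (phi a) => // i _; case: (phi b) => //= j _ ->.
  rewrite -(card_perm_extension gI); set F := [set s | _].
  have pinj : injective (fun f : 'S_n => (f, defined phi)) by move=> ? ? [].
  rewrite -(card_imset (mem F) pinj); congr (_ *+ _).
  apply: eq_card => -[f J]; rewrite -[LHS]/(mk (f, J) == phi).
  apply/eqP/imsetP => [mkE|[f' fP [-> ->]]].
    have phiE a : phi a = if a \in J then Some (f a) else None.
      by rewrite -mkE ffunE.
    exists f; last by congr pair; apply/setP => a; rewrite inE phiE; case: ifP.
    by rewrite inE; apply/forall_inP => a; rewrite inE /g phiE; case: ifP.
  apply/ffunP => a; rewrite ffunE /=; move: fP; rewrite inE => /forall_inP/(_ a).
  by rewrite !inE /g; case: (phi a) => //= i /(_ isT)/eqP->.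
rewrite negb_forall_in => /exists_inP[a aD]; rewrite negb_forall_in => /exists_inP[b bD].
rewrite negb_imply => /andP[/eqP e ab]; rewrite (choice_det_eq0 _ _ _ ab e) ?mul0rn //.
by move: aD; rewrite inE.
Qed.

(* [wick N G M] is the image of det (N G + s M) under s^q |-> q!. *)
Lemma wickE N G M :
  wick N G M =
    \sum_(q < n.+1) (\det (map_mx polyC (N *m G) + 'X *: map_mx polyC M))`_q *+ q`!.
Proof.
rewrite wick_choice_det det_mulmxD_expand.
under [RHS]eq_bigr do rewrite coef_sum -sumrMnl.
rewrite exchange_big; apply: eq_bigr => phi _ /=.
have lt_phi : (#|~: defined phi| < n.+1)%N.
  by rewrite ltnS (leq_trans (max_card _)) ?card_ord.
rewrite (bigD1 (Ordinal lt_phi)) //= coefCM coefXn eqxx mulr1 big1 ?addr0 // => q qphi.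
by rewrite coefCM coefXn -(inj_eq val_inj) /= in qphi *; rewrite (negPf qphi) mulr0 mul0rn.
Qed.
End Wick.

Lemma wick_sym (F : fieldType) (S : comNzRingType) (f : {rmorphism F -> S})
    (n : nat) (Y m : 'M[S]_n) (u v s t : F) :
  let A := (f u)%:M + Y + f s *: m in let B := (f v)%:M + Y + f t *: m in
  wick A B (f (s * t) *: m) = wick B A (f (s * t) *: m).
Proof.
move=> A B; have [st|nst] := eqVneq s t.
  rewrite !wickE; suff -> : A *m B = B *m A by [].
  rewrite /A /B st -!addrA; move: (Y + _) => Z; rewrite !mulmxDl !mulmxDr.
  rewrite (scalar_mxC _ Z) (scalar_mxC (f u) Z) -!scalar_mxM (mulrC (f u)).
  by rewrite -!addrA; congr (_ + _); rewrite addrCA.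
rewrite !wickE; apply: eq_bigr => q _; congr (_`_q *+ _).
(* A B + X s t m = P Q + c and B A + X s t m = Q P + c with P = A + d and
   Q = B - d, for the same scalar c. *)
pose h : {rmorphism F -> {poly S}} := polyC \o f.
pose e (M : 'M[S]_n) := map_mx polyC M.
pose d : {poly S} := h (s * t / (t - s)) * 'X.
pose P := e A + d%:M; pose Q := e B - d%:M.
have dE : d * h t - d * h s = h (s * t) * 'X.
  by rewrite -mulrBr -rmorphB /d mulrAC -rmorphM divfK // subr_eq0 eq_sym.
have dBA : d *: (e B - e A) = 'X *: e (f (s * t) *: m) + (d * h v - d * h u)%:M.
  have -> : e B - e A = (h t - h s) *: e m + (h v - h u)%:M.
    apply/matrixP => i j; rewrite /A /B !mxE !rmorphD /= !rmorphM /= !rmorphMn /=.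
    by rewrite mulrnBl; ring.
  rewrite scalerDr scalerA mulrBr dE scale_scalar_mx mulrBr mulrC -scalerA.
  by congr (_ *: _ + _); apply/matrixP => i j; rewrite !mxE polyCM.
have PQ : P *m Q = e (A *m B) + d *: (e B - e A) - (d * d)%:M.
  rewrite /P /Q mulmxDl !mulmxBr !mul_scalar_mx mul_mx_scalar -map_mxM.
  by rewrite scale_scalar_mx scalerBr -!addrA; congr (_ + _); rewrite addrCA.
have QP : Q *m P = e (B *m A) + d *: (e B - e A) - (d * d)%:M.
  rewrite /P /Q mulmxDr !mulmxBl !mul_scalar_mx mul_mx_scalar -map_mxM.
  by rewrite scale_scalar_mx scalerBr -!addrA; congr (_ + _); rewrite addrCA.
have := det_mulmx_scalarC P Q (- (d * h v - d * h u - d * d)).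
have cE : (- (d * h v - d * h u - d * d))%:M
    = (d * d)%:M - (d * h v - d * h u)%:M :> 'M_n.
  by rewrite opprB raddfB.
rewrite PQ QP dBA cE !addrA !subrK !addrK.
by move/(congr1 (@polyseq S)); apply.
Qed.

Section DetDerivation.
Variables (R : comNzRingType) (n : nat) (M : 'M[R]_n).

Lemma derivation1 (d : {additive R -> R}) :
  (forall p q, d (p * q) = d p * q + p * d q) -> d 1 = 0.
Proof.
by move=> dM; apply: (addIr (d 1)); rewrite add0r -{3}(mulr1 1) dM mulr1 mul1r.
Qed.

Lemma derivation_prod0 (d : {additive R -> R}) (I : Type) (s : seq I)
    (Q : pred I) (F : I -> R) :
    (forall p q, d (p * q) = d p * q + p * d q) ->
  (forall k, Q k -> d (F k) = 0) -> d (\prod_(k <- s | Q k) F k) = 0.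
Proof.
move=> dM F0; have d1 := derivation1 dM.
elim/big_ind: _ => // p q dp dq; by rewrite dM dp dq mul0r mulr0 addr0.
Qed.

Lemma derivation_det0 (d : {additive R -> R}) :
    (forall p q, d (p * q) = d p * q + p * d q) ->
  (forall i j, d (M i j) = 0) -> d (\det M) = 0.
Proof.
move=> dM dM0; rewrite raddf_sum big1 // => s _ /=.
by rewrite raddfMsign derivation_prod0 ?mulr0.
Qed.

Lemma derivation2_det (d : 'I_n -> 'I_n -> {additive R -> R}) :
    (forall i j p q, d i j (p * q) = d i j p * q + p * d i j q) ->
    (forall i j a b, d i j (M a b) = ((i == a) && (j == b))%:R) ->
  forall i j l, d i l (d j i (\det M)) = - d j l (d i i (\det M)).
Proof.
move=> dM dE i j l.
have dnat u v k : d u v (k%:R) = 0.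
  by rewrite raddfMn /= derivation1 ?mul0rn.
have d1P (s : 'S_n) u v (Q : pred 'I_n) : Q u ->
    d u v (\prod_(k | Q k) M k (s k)) = (v == s u)%:R * \prod_(k | Q k && (k != u)) M k (s k).
  move=> Qu; rewrite (bigD1 u) //= dM dE eqxx /= derivation_prod0 ?mulr0 ?addr0 // => k /andP[_ ku].
  by rewrite dE eq_sym (negPf ku).
have d0P (s : 'S_n) u v (Q : pred 'I_n) : ~~ Q u -> d u v (\prod_(k | Q k) M k (s k)) = 0.
  move=> Qu; rewrite derivation_prod0 // => k Qk; rewrite dE.
  by case: eqP => // uk; rewrite uk Qk in Qu.
rewrite /determinant !raddf_sum /=.
under eq_bigr do rewrite !raddfMsign /= d1P // dM dnat mul0r add0r.
under [RHS]eq_bigr do rewrite !raddfMsign /= d1P // dM dnat mul0r add0r.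
have [<-|ij] := eqVneq i j.
  by rewrite !big1 // => s _; rewrite d0P /= ?eqxx ?mulr0 ?oppr0 ?mulr0.
under eq_bigr do rewrite d1P //.
under [RHS]eq_bigr do rewrite d1P 1?eq_sym //.
rewrite (reindex_inj (mulgI (tperm i j))) /=; apply: eq_bigr => s _.
rewrite odd_permM odd_tperm ij signr_addb expr1 mulN1r mulNr mulrN; congr (- (_ * _)).
rewrite !permM tpermL tpermR; congr (_ * (_ * _)); first by rewrite eq_sym.
apply: eq_big => [k|k /andP[kj ki]]; first by rewrite andbC.
by rewrite permM tpermD // eq_sym.
Qed.

End DetDerivation.

Section MapPolyDerivation.
Variables (R : comNzRingType) (d : {additive R -> R}).
Hypothesis dM : forall p q, d (p * q) = d p * q + p * d q.

Lemma map_poly_derivation p q :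
  map_poly d (p * q) = map_poly d p * q + p * map_poly d q.
Proof.
apply/polyP => k; rewrite coef_map coefD !coefM raddf_sum -big_split /=.
by apply: eq_bigr => i _; rewrite dM !coef_map.
Qed.

Lemma map_poly_derivationX : map_poly d 'X = 0.
Proof.
apply/polyP => e; rewrite coef_map coefX coef0 /= raddfMn /=.
by rewrite (derivation1 dM) mul0rn.
Qed.

End MapPolyDerivation.

(* A presentation of the Weyl algebra in the x_(i,a) and the derivations
   D_(i,a) by normally ordered symbols, which are polynomials in x and xi. *)
Record weyl_calculus (C : comNzRingType) (E : algType C) (n r : nat) := {
  sym :> comNzRingType;
  symC : {rmorphism C -> sym};
  x_ : 'I_n -> 'I_r -> sym;
  xi_ : 'I_n -> 'I_r -> sym;
  dx : 'I_n -> 'I_r -> {additive sym -> sym};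
  dxi : 'I_n -> 'I_r -> {additive sym -> sym};
  quant : {additive sym -> E};
  X_ : 'I_n -> 'I_r -> E;
  D_ : 'I_n -> 'I_r -> E;
  dxM : forall i a p q, dx i a (p * q) = dx i a p * q + p * dx i a q;
  dxiM : forall i a p q, dxi i a (p * q) = dxi i a p * q + p * dxi i a q;
  dx_symC : forall i a c, dx i a (symC c) = 0;
  dxi_symC : forall i a c, dxi i a (symC c) = 0;
  dx_x : forall i a j b, dx i a (x_ j b) = ((i == j) && (a == b))%:R;
  dxi_x : forall i a j b, dxi i a (x_ j b) = 0;
  dx_xi : forall i a j b, dx i a (xi_ j b) = 0;
  dxi_xi : forall i a j b, dxi i a (xi_ j b) = ((i == j) && (a == b))%:R;
  quant_symC : forall c p, quant (symC c * p) = c *: quant p;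
  quant1 : quant 1 = 1;
  quant_x : forall i a p, quant (x_ i a * p) = X_ i a * quant p;
  quant_xi : forall i a p, quant (p * xi_ i a) = quant p * D_ i a;
  mul_quant_X : forall i a p, quant p * X_ i a = quant (p * x_ i a + dxi i a p);
  mul_D_quant : forall i a p, D_ i a * quant p = quant (p * xi_ i a + dx i a p)
}.

Section WickTheorem.
Variables (C : comNzRingType) (E : algType C) (n r : nat).
Variable W : weyl_calculus E n r.
Local Notation symC := (symC W).
Local Notation x_ := (x_ W).
Local Notation xi_ := (xi_ W).
Local Notation dx := (dx W).
Local Notation quant := (quant W).

Definition mx_sym : 'M[W]_n := \matrix_(i, j) \sum_a xi_ i a * x_ j a.

Lemma dx_mx_sym i a k j : dx i a (mx_sym k j) = if i == j then xi_ k a else 0.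
Proof.
rewrite mxE raddf_sum /=.
under eq_bigr do rewrite dxM dx_xi mul0r add0r dx_x.
have [_|_] := eqVneq i j; last by rewrite big1 // => b _; rewrite mulr0.
rewrite (bigD1 a) //= eqxx mulr1 big1 ?addr0 // => b.
by rewrite eq_sym => /negPf->; rewrite mulr0.
Qed.

(* The only contractions are between the i-th factors, the only ones that
   involve xi_i on the left and x_i on the right. *)
Lemma quant_prod_wick (a b : 'I_n -> C) (t t' : C) (v w : 'I_n -> 'I_n)
    (s : seq 'I_n) :
  let g i := symC (b i) + symC t' * mx_sym i (w i) in
  let f i := symC (a i) + symC t * mx_sym (v i) i in
  uniq s -> forall rho, {in s, forall i c, dx i c rho = 0} ->
  quant (\prod_(i <- s) g i) * quant (rho * \prod_(i <- s) f i)
  = quant (rho * \prod_(i <- s) (f i * g i + symC (t * t') * mx_sym (v i) (w i))).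
Proof.
move=> g f; elim: s => [|i s IH] /=.
  by move=> _ rho _; rewrite !big_nil !mulr1 quant1 mul1r.
case/andP=> is_s us rho rho0; rewrite !big_cons.
set phi := \prod_(k <- s) g k; set psi := \prod_(k <- s) f k.
set Z := \prod_(k <- s) (_ + _).
have df l k c : dx l c (f k) = if l == k then symC t * xi_ (v k) c else 0.
  rewrite /f raddfD /= dxM !dx_symC mul0r !add0r dx_mx_sym.
  by case: eqP => // _; rewrite mulr0.
have fs c : {in s, forall l, dx l c (f i) = 0}.
  by move=> l ls; rewrite df; have [li|//] := eqVneq l i; rewrite -li ls in is_s.
have psi0 c : dx i c psi = 0.
  rewrite /psi big_seq; apply: (@derivation_prod0 W (dx i c)) => [|l ls]; first exact: dxM.
  by rewrite df; have [il|//] := eqVneq i l; rewrite il ls in is_s.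
have quantg : quant (g i * phi) =
    b i *: quant phi + t' *: \sum_c X_ W (w i) c * quant phi * D_ W i c.
  rewrite /g mulrDl raddfD /= -mulrA !quant_symC mxE mulr_suml.
  congr (_ + _); congr (_ *: _); rewrite raddf_sum; apply: eq_bigr => c _ /=.
  by rewrite -quant_x -quant_xi; congr (quant _); ring.
have step c : quant phi * (D_ W i c * quant (rho * (f i * psi)))
    = quant (rho * (f i * xi_ i c + symC t * xi_ (v i) c) * Z).
  rewrite mul_D_quant -IH //; last first.
    move=> l ls d; rewrite dxM rho0 ?inE ?ls ?orbT // mul0r add0r raddfD /= !dxM.
    by rewrite fs // dx_symC !dx_xi !(mul0r, mulr0, addr0).
  congr (_ * quant _); rewrite !dxM df eqxx psi0 rho0 ?mem_head // -/psi; ring.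
rewrite quantg mulrDl -!scalerAl mulr_suml.
under eq_bigr do rewrite -!mulrA step -quant_x.
rewrite mulrA IH // => [|l ls d]; last first.
  by rewrite dxM rho0 ?inE ?ls ?orbT // fs // mul0r mulr0 addr0.
rewrite -raddf_sum -!quant_symC -raddfD /=; congr (quant _).
transitivity (symC (b i) * (rho * f i * Z) + symC t' * (rho *
    (f i * mx_sym i (w i) + symC t * mx_sym (v i) (w i)) * Z)); last first.
  by rewrite /g [symC (t * _)]rmorphM; ring.
congr (_ + _ * _); rewrite !mxE !mulr_sumr -big_split /= mulr_sumr mulr_suml.
by apply: eq_bigr => c _; ring.
Qed.

Lemma quant_detM (A B : 'M[C]_n) (s t : C) :
  let N := map_mx symC A + symC s *: mx_sym in
  let G := map_mx symC B + symC t *: mx_sym in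
  quant (\det G) * quant (\det N) = quant (wick N G (symC (s * t) *: mx_sym)).
Proof.
move=> N G; rewrite -(det_tr N) /determinant /wick !raddf_sum big_distrlr exchange_big.
apply: eq_bigr => v _; rewrite raddf_sum; apply: eq_bigr => w _ /=.
rewrite -mulrA !raddfMsign /= mulr_signM mulrA -signr_addb addbC; congr (_ * _).
have one0 : {in index_enum 'I_n, forall i c, dx i c (1 : W) = 0}.
  by move=> i _ c; rewrite -(rmorph1 symC) dx_symC.
have := quant_prod_wick (fun i => A (v i) i) (fun i => B i (w i)) s t
  (v : 'I_n -> 'I_n) w (index_enum_uniq _) one0.
rewrite !mul1r => wickvw; rewrite -[RHS]/(quant _).
transitivity (quant (\prod_i (symC (B i (w i)) + symC t * mx_sym i (w i)))
  * quant (\prod_i (symC (A (v i) i) + symC s * mx_sym (v i) i))).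
  by congr (quant _ * quant _); apply: eq_bigr => i _; rewrite !mxE.
rewrite wickvw; congr (quant _); apply: eq_bigr => i _.
by rewrite /N /G !mxE.
Qed.
End WickTheorem.

Lemma quant_det_comm (F : fieldType) (E : algType F) (n r : nat)
    (W : weyl_calculus E n r) (Y : 'M[F]_n) (u v s t : F) :
  let T c d := quant W (\det ((symC W c)%:M + map_mx (symC W) Y
                              + symC W d *: mx_sym W)) in
  T u s * T v t = T v t * T u s.
Proof.
move=> T; have TM c d c' d' : T c d * T c' d' = quant W (wick
    ((symC W c')%:M + map_mx (symC W) Y + symC W d' *: mx_sym W)
    ((symC W c)%:M + map_mx (symC W) Y + symC W d *: mx_sym W)
    (symC W (d' * d) *: mx_sym W)).
  by rewrite /T -!map_scalar_mx -!map_mxD quant_detM.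
by rewrite !TM [t * s]mulrC wick_sym.
Qed.

Lemma mxvec_index_eq (m k : nat) (i j : 'I_m) (a b : 'I_k) :
  (mxvec_index i a == mxvec_index j b) = (i == j) && (a == b).
Proof.
by rewrite /mxvec_index (inj_eq (@cast_ord_inj _ _ _)) (inj_eq enum_rank_inj).
Qed.

Lemma mpoly_algebra_ind (k : nat) (R : comNzRingType) (T : {mpoly R[k]} -> Prop) :
    (forall c, T c%:MP) -> (forall p q, T p -> T q -> T (p + q)) ->
    (forall p i, T p -> T (p * 'X_i)) ->
  forall p, T p.
Proof.
move=> TC TD TX p; elim/mpolyind: p => [|c m p _ _ Tp]; first by rewrite -mpolyC0.
apply: TD => //; rewrite -mul_mpolyC mpolyXE_id.
elim: (index_enum _) => [|i s IH]; first by rewrite big_nil mulr1.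
rewrite big_cons mulrCA; elim: (m i) => [|e IHe]; first by rewrite mul1r.
by rewrite exprS -mulrA mulrC; apply: TX.
Qed.

Lemma mderivXU (k : nat) (R : comNzRingType) (i j : 'I_k) :
  ('X_i : {mpoly R[k]})^`M(j) = (i == j)%:R.
Proof.
rewrite mderivX mnm1E; have [->|ij] := eqVneq i j; last by rewrite scale0r.
rewrite scale1r -mpolyX0; congr 'X_[_].
by apply/mnmP => l; rewrite mnmBE mnm0E subnn.
Qed.

Section WeylAlgebra.
Variables (C : comNzRingType) (n r : nat).
Local Notation P := (polyMat C n r).
Local Notation E := (endo P).
Local Notation S := {mpoly P[n * r]}.

Definition mul_fun_by (f g : P) : P := f * g.
Fact mul_fun_by_is_linear f : linear (mul_fun_by f).
Proof. by move=> a g h; rewrite /mul_fun_by mulrDr scalerAr. Qed.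
HB.instance Definition _ f :=
  GRing.isLinear.Build C P P *:%R (mul_fun_by f) (mul_fun_by_is_linear f).
Definition mul_op (f : P) : E := mul_fun_by f.

Fact mul_op_is_zmod_morphism : zmod_morphism mul_op.
Proof. by move=> f g; apply: endoP => h; rewrite /= /mul_fun_by mulrBl. Qed.
Fact mul_op_is_monoid_morphism : monoid_morphism mul_op.
Proof.
split; first by apply: endoP => h; rewrite /= /mul_fun_by mul1r.
by move=> f g; apply: endoP => h; rewrite /= /mul_fun_by mulrA.
Qed.
HB.instance Definition _ := GRing.isZmodMorphism.Build P E mul_op mul_op_is_zmod_morphism.
HB.instance Definition _ := GRing.isMonoidMorphism.Build P E mul_op mul_op_is_monoid_morphism.

Definition der_fun (k : 'I_(n * r)) (f : P) : P := f^`M(k).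
Fact der_fun_is_linear k : linear (der_fun k).
Proof. by move=> a g h; rewrite /der_fun linearP. Qed.
HB.instance Definition _ k :=
  GRing.isLinear.Build C P P *:%R (der_fun k) (der_fun_is_linear k).
Definition der_op (k : 'I_(n * r)) : E := der_fun k.

Lemma der_opC k l : der_op k * der_op l = der_op l * der_op k.
Proof. by apply: endoP => f; rewrite /= /der_fun mderiv_comm. Qed.

Lemma der_op_mul k f : der_op k * mul_op f = mul_op f * der_op k + mul_op f^`M(k).
Proof.
by apply: endoP => g; rewrite /= /mul_fun_by /der_fun mderivM addrC.
Qed.

Definition symbol_op : S -> E := mmap mul_op der_op.
HB.instance Definition _ := Algebra.Additive.copy symbol_op (mmap mul_op der_op).

Lemma symbol_opZ f s : symbol_op (f *: s) = mul_op f * symbol_op s.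
Proof. exact: mmapZ. Qed.
Lemma symbol_opC f : symbol_op f%:MP = mul_op f.
Proof. exact: mmapC. Qed.

Lemma symbol_opMX s k : symbol_op (s * 'X_k) = symbol_op s * der_op k.
Proof.
elim/mpolyind: s => [|c m s _ _ IH]; first by rewrite mul0r raddf0 mul0r.
rewrite mulrDl !raddfD /= IH mulrDl; congr (_ + _).
rewrite -scalerAl -mpolyXD !symbol_opZ -mulrA; congr (_ * _).
rewrite /symbol_op !mmapX -[der_op k](mmap1U der_op k) /mmap1 -prodrM_comm.
  by apply: eq_bigr => i _; rewrite mnmDE exprD.
by move=> i j _ _; apply/commrX/commr_sym/commrX/der_opC.
Qed.

Definition xder (k : 'I_(n * r)) : S -> S := map_mpoly (mderiv k).

Lemma xder_is_additive k : zmod_morphism (xder k).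
Proof. exact: raddfB. Qed.
HB.instance Definition _ k := GRing.isZmodMorphism.Build S S (xder k) (xder_is_additive k).

Lemma mcoeff_xder k s m : (xder k s)@_m = (s@_m)^`M(k).
Proof. exact: mcoeff_map_mpoly. Qed.

Lemma xderC k f : xder k f%:MP = (f^`M(k))%:MP.
Proof. exact: map_mpolyC. Qed.

Lemma xderX k l : xder k 'X_l = 0.
Proof. by apply/mpolyP => m; rewrite mcoeff_xder mcoeffX mcoeff0 -mpolyC_nat mderivC. Qed.

Lemma xderM k s1 s2 : xder k (s1 * s2) = xder k s1 * s2 + s1 * xder k s2.
Proof.
apply/mpolyP => m; rewrite mcoeff_xder mcoeffD !mcoeffM raddf_sum -big_split /=.
by apply: eq_bigr => i _; rewrite mderivM !mcoeff_xder.
Qed.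

Lemma der_symbol_op k s : der_op k * symbol_op s = symbol_op (s * 'X_k + xder k s).
Proof.
elim/mpoly_algebra_ind: s => [f|s1 s2 IH1 IH2|s l IH].
- by rewrite xderC raddfD /= symbol_opMX !symbol_opC der_op_mul.
- by rewrite raddfD mulrDr IH1 IH2 -raddfD /= mulrDl [xder k (s1 + s2)]raddfD addrACA.
rewrite symbol_opMX mulrA IH -symbol_opMX; congr symbol_op.
by rewrite xderM xderX mulr0 addr0 mulrDl -!mulrA ['X_l * _]mulrC.
Qed.

Lemma symbol_op_mul s l :
  symbol_op s * mul_op 'X_l = symbol_op (s * ('X_l)%:MP + s^`M(l)).
Proof.
elim/mpoly_algebra_ind: s => [f|s1 s2 IH1 IH2|s k IH].
- by rewrite mderivC addr0 -mpolyCM !symbol_opC rmorphM.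
- by rewrite raddfD mulrDl IH1 IH2 -raddfD /= mulrDl mderivD addrACA.
rewrite symbol_opMX -mulrA der_op_mul mulrDr mulrA IH -symbol_opMX mderivXU rmorph_nat.
rewrite mulr_natr -raddfMn -raddfD mderivM mderivXU mulr_natr mulrDl eq_sym.
by rewrite -!mulrA [('X_l)%:MP * _]mulrC addrA.
Qed.
End WeylAlgebra.
Arguments der_op {C n r} k.

Section CharacteristicCoefficients.
Variables (C : comNzRingType) (n : nat).
Local Notation Y := {mpoly C[n * n]}.

Definition yder i j : Y -> Y := mderiv (mxvec_index i j).
HB.instance Definition _ i j := GRing.Linear.copy (yder i j) (mderiv (mxvec_index i j)).

Definition trder (h : Y) : Y := \sum_i yder i i h.
Fact trder_is_linear : linear trder.
Proof.
move=> a p q; rewrite /trder scaler_sumr -big_split /=.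
by apply: eq_bigr => i _; rewrite linearP.
Qed.
HB.instance Definition _ := GRing.isLinear.Build C Y Y *:%R trder trder_is_linear.

Lemma yderM i j p q : yder i j (p * q) = yder i j p * q + p * yder i j q.
Proof. exact: mderivM. Qed.

Lemma yderC i j k l p : yder i j (yder k l p) = yder k l (yder i j p).
Proof. exact: mderiv_comm. Qed.

Lemma trderM p q : trder (p * q) = trder p * q + p * trder q.
Proof.
rewrite /trder mulr_suml mulr_sumr -big_split /=.
by apply: eq_bigr => i _; rewrite yderM.
Qed.

Lemma yder_trder i j p : yder i j (trder p) = trder (yder i j p).
Proof. by rewrite /trder raddf_sum; apply: eq_bigr => k _; rewrite /= yderC. Qed.

Lemma yderX i j k l : yder i j 'X_(mxvec_index k l) = ((i == k) && (j == l))%:R.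
Proof.
by rewrite /yder mderivXU mxvec_index_eq ![_ == k]eq_sym ![_ == l]eq_sym.
Qed.

Lemma trderX i j : trder 'X_(mxvec_index i j) = (i == j)%:R.
Proof.
rewrite /trder; under eq_bigr do rewrite yderX.
by rewrite (bigD1 i) //= eqxx big1 ?addr0 // => k /negPf->.
Qed.

Definition chi : {poly Y} := \det ('X%:M + map_mx polyC (generic_mx C n)).

Definition minor_like (h : Y) :=
  forall i j l, yder i l (yder j i h) = - yder j l (yder i i h).

Lemma minor_like_yder i j h : minor_like h -> minor_like (yder i j h).
Proof.
by move=> hm k l m; rewrite ![yder _ _ (yder i j h)]yderC ![yder _ _ (yder i j _)]yderC hm raddfN.
Qed.

Lemma minor_like_trder h : minor_like h -> minor_like (trder h).
Proof.
by move=> hm i j l; rewrite !yder_trder hm raddfN.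
Qed.

Lemma minor_like_chi a : minor_like (chi`_a).
Proof.
move=> i j l.
pose d u v : {additive {poly Y} -> {poly Y}} := map_poly (yder u v).
have dM u v := map_poly_derivation (@yderM u v).
have dE u v k m : d u v (('X%:M + map_mx polyC (generic_mx C n)) k m)
    = ((u == k) && (v == m))%:R.
  rewrite !mxE raddfD raddfMn /= map_polyC /= yderX polyC_natr.
  by rewrite (map_poly_derivationX (@yderM u v)) mul0rn add0r.
have := derivation2_det dM dE i j l.
move=> /(congr1 (fun p : {poly Y} => p`_a)); rewrite coefN.
by rewrite !coef_map.
Qed.

Lemma trder_chi a : trder (chi`_a) = chi`_a.+1 *+ a.+1.
Proof.
pose d : {additive {poly Y} -> {poly Y}} := map_poly trder \- deriv.
have dM p q : d (p * q) = d p * q + p * d q.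
  by rewrite /= (map_poly_derivation trderM) derivM; ring.
have /(congr1 (fun p : {poly Y} => p`_a)) : d chi = 0.
  apply: derivation_det0 => // i j; rewrite !mxE /= raddfD /= derivD derivC addr0.
  rewrite map_polyC /= !raddfMn /= derivX.
  rewrite (map_poly_derivationX trderM) mul0rn add0r trderX polyC_natr.
  by rewrite mulNrn subrr.
by rewrite coefB coef_map coef_deriv coef0 => /eqP; rewrite subr_eq0 => /eqP.
Qed.

End CharacteristicCoefficients.

Section PrincipalMinors.
Variables (R : comNzRingType) (n : nat) (Y : 'M[R]_n).

Lemma det_rows_principal (I : {set 'I_n}) :
  \det (\matrix_(i, j) if i \in I then Y i j else (i == j)%:R)
  = \det (mxsub (@enum_val _ (mem I)) (@enum_val _ (mem I)) Y).
Proof.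
pose f := @enum_val _ (mem I).
pose F : 'M[R]_(_, n) := rowsub f 1%:M; pose Z := rowsub f (Y - 1%:M).
have -> : \matrix_(i, j) (if i \in I then Y i j else (i == j)%:R) = 1%:M + F^T *m Z.
  apply/matrixP => i j; rewrite !mxE.
  have -> : \sum_a F^T i a * Z a j = \sum_(k in I) (k == i)%:R * (Y k j - (k == j)%:R).
    by rewrite [RHS]big_enum_val; apply: eq_bigr => a _; rewrite !mxE.
  case: ifP => iI; last first.
    rewrite big1 ?addr0 // => k kI; case: eqP => [ki|]; last by rewrite mul0r.
    by rewrite -ki kI in iI.
  rewrite (bigD1 i) //= eqxx mul1r big1 ?addr0 => [|k /andP[_ /negPf->]].
    by rewrite addrC subrK.
  by rewrite mul0r.
rewrite det_addMC; congr (\det _); apply/matrixP => a b; rewrite !mxE.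
rewrite (bigD1 (f b)) //= big1 => [|k kb]; last first.
  by rewrite !mxE [f b == k]eq_sym (negPf kb) mulr0.
rewrite !mxE eqxx mulr1 addr0 (inj_eq enum_val_inj).
by rewrite addrC subrK.
Qed.

Lemma coef_det_addX k : (k <= n)%N ->
  (\det ('X%:M + map_mx polyC Y))`_(n - k)
  = \sum_(I : {set 'I_n} | #|I| == k)
      \det (mxsub (@enum_val _ (mem I)) (@enum_val _ (mem I)) Y).
Proof.
move=> kn.
have -> : \det ('X%:M + map_mx polyC Y) = \sum_(I : {set 'I_n})
    (\det (\matrix_(i, j) if i \in I then Y i j else (i == j)%:R))%:P * 'X^(n - #|I|).
  transitivity (\sum_(s : 'S_n) \sum_(I : {set 'I_n}) (-1) ^+ s *
      \prod_i (if i \in I then (Y i (s i))%:P else 'X *+ (i == s i))).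
    apply: eq_bigr => s _; rewrite -mulr_sumr -bigA_distr; congr (_ * _).
    by apply: eq_bigr => i _; rewrite !mxE addrC.
  rewrite exchange_big; apply: eq_bigr => I _ /=.
  rewrite rmorph_sum mulr_suml; apply: eq_bigr => s _ /=.
  rewrite rmorphM rmorph_sign -mulrA; congr (_ * _); rewrite rmorph_prod /=.
  have -> : (n - #|I|)%N = #|~: I| by rewrite [RHS]cardsCs setCK card_ord.
  rewrite -prodr_const [X in _ = _ * X]big_mkcond -big_split /=.
  apply: eq_bigr => i _; rewrite mxE inE; case: ifP => _ /=; first by rewrite mulr1.
  by case: (i == s i); rewrite ?mul1r // mul0r.
rewrite coef_sum [RHS]big_mkcond; apply: eq_bigr => I _.
rewrite coefCM coefXn det_rows_principal.
have In : (#|I| <= n)%N by rewrite (leq_trans (max_card _)) ?card_ord.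
have -> : (n - k == n - #|I|)%N = (#|I| == k).
  by rewrite eqn_sub2lE // eq_sym.
by case: ifP; rewrite ?mulr1 ?mulr0.
Qed.

End PrincipalMinors.

Lemma cpoly_chi (C : comNzRingType) (n k : nat) : (k <= n)%N ->
  cpoly C n k = (chi C n)`_(n - k).
Proof. by move=> kn; rewrite /chi coef_det_addX. Qed.

Section CoefficientExtraction.
Variables (F : numFieldType) (V : lmodType F).

Lemma polynomial_coef_eq0 (N : nat) (v : 'I_N -> V) :
  (forall c : F, \sum_(k < N) c ^+ k *: v k = 0) -> forall k, v k = 0.
Proof.
move=> v0 k.
pose a : 'rV[F]_N := \row_i (i : nat)%:R; pose A := Vandermonde N a.
have Au : A \in unitmx.
  rewrite unitmxE unitfE det_Vandermonde; apply/prodf_neq0 => i _.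
  apply/prodf_neq0 => j ij; rewrite !mxE subr_eq0 Num.Theory.eqr_nat.
  by rewrite gtn_eqF.
transitivity (\sum_l (A *m invmx A) l k *: v l).
  rewrite mulmxV // (bigD1 k) //= mxE eqxx scale1r big1 ?addr0 // => l.
  by rewrite mxE => /negPf->; rewrite scale0r.
under eq_bigr do rewrite mxE scaler_suml.
rewrite exchange_big big1 // => j _ /=.
rewrite (_ : \sum_l _ =
    invmx A j k *: \sum_(l < N) ((j : nat)%:R : F) ^+ l *: v l).
  by rewrite v0 scaler0.
by rewrite scaler_sumr; apply: eq_bigr => l _; rewrite !mxE scalerA mulrC.
Qed.

End CoefficientExtraction.

Lemma comm_polynomial_coef (F : numFieldType) (E : algType F) (z : E) (N : nat) (v : 'I_N -> E) :
  (forall c : F, GRing.comm z (\sum_(k < N) c ^+ k *: v k)) ->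
  forall k, GRing.comm z (v k).
Proof.
move=> zv k; apply/eqP; rewrite -subr_eq0; apply/eqP.
apply: (polynomial_coef_eq0 (v := fun k => z * v k - v k * z)) => c.
under eq_bigr do rewrite scalerBr scalerAr scalerAl.
by rewrite sumrB -mulr_sumr -mulr_suml zv subrr.
Qed.

Section Taylor.
Variables (C : comNzRingType) (E : algType C) (n r : nat).
Variables (W : weyl_calculus E n r) (Y : 'M[C]_n).
Local Notation symC := (symC W).
Local Notation quant := (quant W).

Definition taylor_mx : 'M[{poly W}]_n :=
  map_mx (polyC \o symC) Y + 'X *: map_mx polyC (mx_sym W).

(* h |-> h (Y + t m), where t is the variable of the polynomial. *)
Definition taylor : {mpoly C[n * n]} -> {poly W} :=
  mmap (polyC \o symC) (fun k => mxvec taylor_mx 0 k).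
HB.instance Definition _ := GRing.RMorphism.copy taylor
  (mmap (polyC \o symC) (fun k => mxvec taylor_mx 0 k)).

Lemma taylorC c : taylor c%:MP = (symC c)%:P.
Proof. by rewrite /taylor mmapC. Qed.

Lemma taylorX i j : taylor 'X_(mxvec_index i j) = taylor_mx i j.
Proof. by rewrite /taylor mmapX mmap1U mxvecE. Qed.

Lemma taylor_derivation (d : {additive {poly W} -> {poly W}}) h :
    (forall p q, d (p * q) = d p * q + p * d q) ->
    (forall c, d (symC c)%:P = 0) ->
  d (taylor h) = \sum_i \sum_j taylor (yder i j h) * d (taylor_mx i j).
Proof.
move=> dM dC; elim/mpoly_algebra_ind: h => [c|p q IHp IHq|p k IH].
- rewrite taylorC dC big1 // => i _; rewrite big1 // => j _.
  by rewrite /yder mderivC rmorph0 mul0r.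
- rewrite rmorphD raddfD /= IHp IHq -big_split; apply: eq_bigr => i _ /=.
  by rewrite -big_split; apply: eq_bigr => j _ /=; rewrite raddfD rmorphD mulrDl.
case/mxvec_indexP: k => k l.
rewrite rmorphM /= dM IH taylorX.
transitivity (\sum_i \sum_j (taylor (yder i j p) * d (taylor_mx i j) * taylor_mx k l
  + ((i == k) && (j == l))%:R * (taylor p * d (taylor_mx i j)))).
  under [RHS]eq_bigr do rewrite big_split /= -mulr_suml.
  rewrite big_split /= -mulr_suml; congr (_ + _).
  rewrite (bigD1 k) //= (bigD1 l) //= !eqxx mul1r !big1 ?addr0 // => [i /negPf ik|j /negPf->].
    by rewrite big1 // => j _; rewrite ik mul0r.
  by rewrite andbF mul0r.
apply: eq_bigr => i _; apply: eq_bigr => j _.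
rewrite yderM yderX rmorphD !rmorphM rmorph_nat /= taylorX.
by rewrite mulrDl -!mulrA; congr (_ + _); [rewrite [X in _ * X = _]mulrC | rewrite mulrCA].
Qed.

Lemma deriv_taylor h :
  (taylor h)^`() = \sum_i \sum_j taylor (yder i j h) * (mx_sym W i j)%:P.
Proof.
rewrite (@taylor_derivation (@deriv _)) => [|p q|c]; last exact: derivC.
  apply: eq_bigr => i _; apply: eq_bigr => j _; congr (_ * _).
  by rewrite !mxE /= derivD derivC add0r derivM derivX derivC mulr0 addr0 mul1r.
exact: derivM.
Qed.

Lemma dxi_mx_sym i a k j : dxi W i a (mx_sym W k j) = if i == k then x_ W j a else 0.
Proof.
rewrite mxE raddf_sum /=.
under eq_bigr do rewrite dxiM dxi_x mulr0 addr0 dxi_xi.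
have [_|_] := eqVneq i k; last by rewrite big1 // => b _; rewrite mul0r.
rewrite (bigD1 a) //= eqxx mul1r big1 ?addr0 // => b.
by rewrite eq_sym => /negPf->; rewrite mul0r.
Qed.

Lemma dxi_taylor i a h q : dxi W i a (taylor h)`_q
  = (\sum_l taylor (yder i l h) * ('X * (x_ W l a)%:P))`_q.
Proof.
pose d : {additive {poly W} -> {poly W}} := map_poly (dxi W i a).
have dM p1 p2 : d (p1 * p2) = d p1 * p2 + p1 * d p2.
  by rewrite /d /= (map_poly_derivation (@dxiM _ _ _ _ W i a)).
have dC c : d (symC c)%:P = 0 by rewrite /d /= map_polyC /= dxi_symC.
have dE k l : d (taylor_mx k l) = 'X * (dxi W i a (mx_sym W k l))%:P.
  rewrite !mxE raddfD /= dC add0r dM /d /= (map_poly_derivationX (@dxiM _ _ _ _ W i a)).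
  by rewrite mul0r add0r map_polyC.
rewrite -[LHS]/(dxi W i a (taylor h)`_q) -coef_map -[map_poly _ _]/(d _) taylor_derivation //.
congr ((polyseq _)`_q); rewrite (bigD1 i) //= [X in _ + X]big1 ?addr0 => [|k ki].
  apply: eq_bigr => l _; congr (_ * _).
  by rewrite dE dxi_mx_sym eqxx.
by rewrite big1 // => l _; rewrite dE dxi_mx_sym eq_sym (negPf ki) mulr0 mulr0.
Qed.

Definition gl_quant i j : E := \sum_a X_ W i a * D_ W j a.

Lemma taylor_kirillov_wei q h : minor_like h ->
  \sum_i \sum_j quant (taylor (yder j i h))`_q * gl_quant i j
  = quant (taylor h)`_q.+1 *+ q.+1 - quant (taylor (trder h))`_q *+ q.
Proof.
move=> hm; pose p i j := (taylor (yder j i h))`_q.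
have step i j : quant (p i j) * gl_quant i j = quant (p i j * mx_sym W j i
    + (\sum_l taylor (yder i l (yder j i h)) * ('X * (mx_sym W j l)%:P))`_q).
  rewrite /gl_quant mulr_sumr.
  under eq_bigr do rewrite mulrA mul_quant_X -quant_xi mulrDl dxi_taylor.
  rewrite -raddf_sum big_split /=; congr (quant (_ + _)).
    by rewrite mxE mulr_sumr; apply: eq_bigr => a _; rewrite -mulrA [x_ _ _ _ * _]mulrC.
  rewrite coef_sum; under eq_bigr do rewrite coef_sum mulr_suml.
  rewrite exchange_big; apply: eq_bigr => l _ /=.
  rewrite [mx_sym W j l]mxE (rmorph_sum (@polyC W)) !mulr_sumr coef_sum; apply: eq_bigr => a _.
  by rewrite -coefMC -!mulrA -rmorphM [x_ _ _ _ * _]mulrC.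
under eq_bigr do under eq_bigr do rewrite step.
under eq_bigr do rewrite -raddf_sum.
rewrite -raddf_sum -!raddfMn -raddfB /=; congr (quant _).
under eq_bigr do rewrite big_split /=.
rewrite big_split /= -coef_deriv; congr (_ + _).
  rewrite deriv_taylor coef_sum exchange_big; apply: eq_bigr => i _.
  by rewrite coef_sum; apply: eq_bigr => j _ /=; rewrite coefMC.
have second : \sum_i \sum_j \sum_l
      taylor (yder i l (yder j i h)) * ('X * (mx_sym W j l)%:P)
    = - ('X * (taylor (trder h))^`()).
  rewrite deriv_taylor exchange_big mulr_sumr -sumrN; apply: eq_bigr => j _ /=.
  rewrite exchange_big mulr_sumr -sumrN; apply: eq_bigr => l _ /=.
  rewrite -mulr_suml [in RHS]mulrCA -mulNr; congr (_ * _).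
  rewrite /trder (raddf_sum (yder j l)) (raddf_sum taylor) -sumrN.
  apply: eq_bigr => i _ /=.
  by rewrite hm rmorphN.
transitivity ((- ('X * (taylor (trder h))^`()))`_q).
  rewrite -second coef_sum; apply: eq_bigr => i _.
  by rewrite coef_sum.
rewrite coefN coefXM; case: q {p step} => [|q] /=; first by rewrite mulr0n.
by rewrite coef_deriv.
Qed.

End Taylor.

Section CommutingCoefficients.
Variables (F : numFieldType) (E : algType F) (n r : nat).
Variables (W : weyl_calculus E n r) (Y : 'M[F]_n).
Local Notation symC := (symC W).

Definition taylor_chi a q : E := quant W (taylor W Y (chi F n)`_a)`_q.

Lemma quant_det_taylor_chi : exists N Q, [/\
    forall u s : F, quant W (\det ((symC u)%:M + map_mx symC Y + symC s *: mx_sym W))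
      = \sum_(a < N) u ^+ a *: \sum_(q < Q) s ^+ q *: taylor_chi a q,
    forall a q, (N <= a)%N -> taylor_chi a q = 0 &
    forall a q, (Q <= q)%N -> taylor_chi a q = 0].
Proof.
pose N := size (chi F n); pose tc a := taylor W Y (chi F n)`_a.
pose Q := (\max_(a < N) size (tc a))%N.
have tc0 a : (N <= a)%N -> tc a = 0.
  by move=> Na; rewrite /tc nth_default // rmorph0.
have sizeQ a : (size (tc a) <= Q)%N.
  have [Na|aN] := leqP N a; first by rewrite tc0 ?size_poly0.
  exact: (leq_bigmax (Ordinal aN)).
exists N, Q; split=> [u s|a q Na|a q Qq]; last first.
- by rewrite /taylor_chi nth_default ?raddf0 // (leq_trans (sizeQ a)).
- by rewrite /taylor_chi -/(tc a) tc0 // coef0 raddf0.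
pose ev : {rmorphism {mpoly F[n * n]} -> W} := horner_eval (symC s) \o taylor W Y.
pose ev2 : {rmorphism {poly {mpoly F[n * n]}} -> W} := horner_eval (symC u) \o map_poly ev.
have -> : (symC u)%:M + map_mx symC Y + symC s *: mx_sym W
    = map_mx ev2 ('X%:M + map_mx polyC (generic_mx F n)).
  apply/matrixP => i j; rewrite !mxE /ev2 /= raddfD raddfMn /= map_polyX map_polyC /=.
  rewrite /horner_eval hornerD hornerC hornerMn hornerX taylorX !mxE.
  by rewrite !hornerE.
rewrite det_map_mx -[\det _]/(chi F n).
rewrite /ev2 /= /horner_eval [map_poly _ _]/map_poly horner_poly.
rewrite raddf_sum; apply: eq_bigr => a _ /=.
rewrite /horner_eval (horner_coef_wide _ (sizeQ a)) mulr_suml raddf_sum scaler_sumr.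
apply: eq_bigr => q _ /=.
by rewrite -!rmorphXn mulrC quant_symC [_ * symC _]mulrC quant_symC.
Qed.

Lemma taylor_chi_comm a q b k : GRing.comm (taylor_chi a q) (taylor_chi b k).
Proof.
have [N [Q [TE N0 Q0]]] := quant_det_taylor_chi.
have coef (z : E) : (forall u s : F,
    GRing.comm z (quant W (\det ((symC u)%:M + map_mx symC Y + symC s *: mx_sym W)))) ->
    forall a q, GRing.comm z (taylor_chi a q).
  move=> zT a' q'.
  have [aN|Na] := ltnP a' N; last by rewrite N0 //; apply: commr0.
  have [qQ|Qq] := ltnP q' Q; last by rewrite Q0 //; apply: commr0.
  apply: (comm_polynomial_coef (v := fun q : 'I_Q => taylor_chi a' q) _ (Ordinal qQ)) => s.
  apply: (comm_polynomial_coef (v := fun a : 'I_N =>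
    \sum_(q < Q) s ^+ q *: taylor_chi a q) _ (Ordinal aN)) => u.
  by rewrite -TE.
apply: (coef _) => u s; apply/commr_sym; apply: (coef _) => v t.
exact: quant_det_comm.
Qed.

End CommutingCoefficients.

Section KirillovWei.
Variables (C : comNzRingType) (n r : nat) (Y : 'M[C]_n).
Local Notation E := (endo (polyMat C n r)).
Local Notation kw := (@kirillov_wei C n r).

Lemma comm_alg (A : algType C) (x : A) c : GRing.comm x c%:A.
Proof. by rewrite /GRing.comm -scalerAl -scalerAr mul1r mulr1. Qed.

Lemma polymap_eval_morph : monoid_morphism ((@polymap_eval C n r)^~ Y).
Proof.
have [] // := @commr_mmap_is_multiplicative (n * n) E E (fun k => (mxvec Y 0 k)%:A) idfun.
- by move=> i x; apply: comm_alg.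
- move=> p m m'; rewrite /mmap1; elim/big_ind: _ => [|x y|i _]; first exact: commr1.
    exact: commrM.
  exact/commrX/comm_alg.
Qed.

Lemma polymap_evalD G H :
  polymap_eval (G + H : polymap C n r) Y = polymap_eval G Y + polymap_eval H Y.
Proof. exact: mmapD. Qed.

Lemma polymap_eval_sum (I : Type) (s : seq I) (G : I -> polymap C n r) :
  polymap_eval (\sum_(i <- s) G i) Y = \sum_(i <- s) polymap_eval (G i) Y.
Proof. exact: (raddf_sum (mmap idfun _)). Qed.

Lemma polymap_evalMC G c :
  polymap_eval (G * c%:MP : polymap C n r) Y = polymap_eval G Y * c.
Proof. by rewrite polymap_eval_morph.2 /polymap_eval mmapC. Qed.

Lemma kirillov_wei_deriv k G : (kw G)^`M(k) = kw G^`M(k).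
Proof.
rewrite /kirillov_wei (raddf_sum (mderiv k)); apply: eq_bigr => i _ /=.
rewrite (raddf_sum (mderiv k)); apply: eq_bigr => j _ /=.
by rewrite mderivM mderivC mulr0 addr0 mderiv_comm.
Qed.

Lemma iter_kirillov_wei_deriv q k G : (iter q kw G)^`M(k) = iter q kw G^`M(k).
Proof. by elim: q => //= q IH; rewrite kirillov_wei_deriv IH. Qed.

Definition kw_eval q (h : {mpoly C[n * n]}) : E :=
  polymap_eval (iter q kw (map_mpoly (in_alg E) h)) Y.

Lemma kw_evalS q h :
  kw_eval q.+1 h = \sum_i \sum_j kw_eval q (yder j i h) * glL C r i j.
Proof.
rewrite /kw_eval iterS {1}/kirillov_wei polymap_eval_sum; apply: eq_bigr => i _.
rewrite polymap_eval_sum; apply: eq_bigr => j _; rewrite polymap_evalMC.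
rewrite iter_kirillov_wei_deriv; congr (polymap_eval (iter _ _ _) _ * _).
apply/mpolyP => m; rewrite mcoeff_deriv !mcoeff_map_mpoly /= mcoeff_deriv.
by rewrite scalerMnl.
Qed.

Variable W : weyl_calculus E n r.
Hypothesis WE : forall i j, gl_quant W i j = glL C r i j.

Lemma kw_eval0 h : kw_eval 0 h = quant W (taylor W Y h)`_0.
Proof.
rewrite /kw_eval /=.
transitivity (h.@[fun k => mxvec Y 0 k]%:A : E).
  elim/mpoly_algebra_ind: h => [c|p q IHp IHq|p k IH].
  - by rewrite map_mpolyC mevalC /polymap_eval mmapC.
  - rewrite mevalD scalerDl -IHp -IHq -polymap_evalD.
    by congr (polymap_eval _ _); apply: raddfD.
  rewrite rmorphM mevalM mevalXU /= map_mpolyX polymap_eval_morph.2 IH.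
  by rewrite /polymap_eval mmapX mmap1U -scalerAl mul1r scalerA.
have -> : (taylor W Y h)`_0 = symC W h.@[fun k => mxvec Y 0 k].
  elim/mpoly_algebra_ind: h => [c|p q IHp IHq|p k IH].
  - by rewrite taylorC coefC mevalC.
  - by rewrite (raddfD (taylor W Y)) mevalD coefD IHp IHq raddfD.
  case/mxvec_indexP: k => i j.
  rewrite rmorphM /= coef0M IH mevalM mevalXU mxvecE taylorX rmorphM /=.
  by rewrite !mxE coefD coefC coefXM addr0.
by rewrite -[symC _ _]mulr1 quant_symC quant1.
Qed.

(* The coefficients do not depend on h, so that the induction hypothesis applies
   to the derivatives of h. *)
Lemma kw_eval_taylor q : exists s : seq (C * (nat * nat)),
  forall h, minor_like h -> kw_eval q h =
    \sum_(p <- s) p.1 *: quant W (taylor W Y (iter p.2.1 (@trder C n) h))`_p.2.2.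
Proof.
elim: q => [|q [s IH]].
  by exists [:: (1, (0, 0))] => h _; rewrite big_seq1 scale1r kw_eval0.
exists ([seq (p.1 *+ p.2.2.+1, (p.2.1, p.2.2.+1)) | p <- s]
     ++ [seq (- (p.1 *+ p.2.2), (p.2.1.+1, p.2.2)) | p <- s]) => h hm.
rewrite kw_evalS big_cat /= !big_map -big_split /=.
have hmi b : minor_like (iter b (@trder C n) h).
  by elim: b => //= b; apply: minor_like_trder.
transitivity (\sum_(p <- s) p.1 *: \sum_i \sum_j
    quant W (taylor W Y (yder j i (iter p.2.1 (@trder C n) h)))`_p.2.2 * gl_quant W i j).
  under [RHS]eq_bigr do rewrite scaler_sumr.
  rewrite [RHS]exchange_big; apply: eq_bigr => i _ /=.
  under [RHS]eq_bigr do rewrite scaler_sumr.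
  rewrite [RHS]exchange_big; apply: eq_bigr => j _ /=.
  rewrite WE IH; last exact: minor_like_yder.
  rewrite mulr_suml; apply: eq_bigr => p _; rewrite -scalerAl.
  have -> // : iter p.2.1 (@trder C n) (yder j i h) = yder j i (iter p.2.1 (@trder C n) h).
  by elim: p.2.1 => //= b ->; rewrite yder_trder.
apply: eq_bigr => p _; rewrite taylor_kirillov_wei // scalerBr.
by rewrite -!scalerMnr -!scalerMnl scaleNr -scalerMnl.
Qed.

End KirillovWei.

Section PolynomialSymbols.
Variables (C : comNzRingType) (n r : nat).
Local Notation P := (polyMat C n r).
Local Notation S := {mpoly P[n * r]}.
Implicit Types (i j : 'I_n) (a b : 'I_r) (p : S).

Definition scalar_symbol : {rmorphism C -> S} := (@mpolyC _ P) \o (@mpolyC _ C).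
Definition x_symbol i a : S := (xvar C i a)%:MP.
Definition xi_symbol i a : S := 'X_(mxvec_index i a).

Lemma xder_scalar_symbol i a c : xder (mxvec_index i a) (scalar_symbol c) = 0.
Proof. by rewrite xderC mderivC mpolyC0. Qed.

Lemma mderiv_scalar_symbol i a c : (scalar_symbol c)^`M(mxvec_index i a) = 0.
Proof. exact: mderivC. Qed.

Lemma xder_x_symbol i a j b :
  xder (mxvec_index i a) (x_symbol j b) = ((i == j) && (a == b))%:R.
Proof.
by rewrite xderC mderivXU mxvec_index_eq mpolyC_nat ![_ == j]eq_sym ![_ == b]eq_sym.
Qed.

Lemma mderiv_x_symbol i a j b : (x_symbol j b)^`M(mxvec_index i a) = 0.
Proof. exact: mderivC. Qed.

Lemma xder_xi_symbol i a j b : xder (mxvec_index i a) (xi_symbol j b) = 0.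
Proof. exact: xderX. Qed.

Lemma mderiv_xi_symbol i a j b :
  (xi_symbol j b)^`M(mxvec_index i a) = ((i == j) && (a == b))%:R.
Proof. by rewrite mderivXU mxvec_index_eq ![_ == j]eq_sym ![_ == b]eq_sym. Qed.

Lemma symbol_op_scalar c p : symbol_op (scalar_symbol c * p) = c *: symbol_op p.
Proof.
rewrite mul_mpolyC symbol_opZ; apply: endoP => f.
by rewrite /= /mul_fun_by mul_mpolyC.
Qed.

Lemma symbol_op1 : symbol_op (1 : S) = 1.
Proof. by rewrite -mpolyC1 symbol_opC rmorph1. Qed.

Lemma symbol_op_x i a p : symbol_op (x_symbol i a * p) = mul_op (xvar C i a) * symbol_op p.
Proof. by rewrite mul_mpolyC symbol_opZ. Qed.

Definition polynomial_symbols : weyl_calculus (endo P) n r := {|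
  dx := fun i a => xder (mxvec_index i a);
  dxi := fun i a => mderiv (mxvec_index i a);
  dxM := fun i a => xderM (mxvec_index i a);
  dxiM := fun i a => @mderivM _ _ (mxvec_index i a);
  dx_symC := xder_scalar_symbol;
  dxi_symC := mderiv_scalar_symbol;
  dx_x := xder_x_symbol;
  dxi_x := mderiv_x_symbol;
  dx_xi := xder_xi_symbol;
  dxi_xi := mderiv_xi_symbol;
  quant_symC := symbol_op_scalar;
  quant1 := symbol_op1;
  quant_x := symbol_op_x;
  quant_xi := fun i a p => symbol_opMX p (mxvec_index i a);
  mul_quant_X := fun i a p => symbol_op_mul p (mxvec_index i a);
  mul_D_quant := fun i a => der_symbol_op (mxvec_index i a)
|}.

Lemma gl_quant_polynomial i j : gl_quant polynomial_symbols i j = glL C r i j.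
Proof.
apply: endoP => f; rewrite /gl_quant.
have sumE (I : Type) (s : seq I) (F : I -> endo P) :
    (\sum_(k <- s) F k : endo P) f = \sum_(k <- s) F k f.
  by elim: s => [|k s IH]; rewrite ?big_nil // !big_cons -IH.
by rewrite sumE.
Qed.

End PolynomialSymbols.

Lemma iter_trder_chi (C : comNzRingType) (n a b : nat) : exists k,
  iter b (@trder C n) (chi C n)`_a = (chi C n)`_(a + b) *+ k.
Proof.
elim: b => [|b [k IH]]; first by exists 1; rewrite addn0.
exists ((a + b).+1 * k)%N.
by rewrite iterS IH raddfMn /= trder_chi addnS mulrnA.
Qed.

Lemma bigM_comm (F : numFieldType) (n r : nat) (Y : 'M[F]_n) (p q p' q' : nat) :
    (p + q <= n)%N -> (p' + q' <= n)%N ->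
  GRing.comm (polymap_eval (bigM F n r p q) Y) (polymap_eval (bigM F n r p' q') Y).
Proof.
pose W := polynomial_symbols F n r.
have bigME p0 q0 (z : endo (polyMat F n r)) : (p0 + q0 <= n)%N ->
    (forall a k, GRing.comm z (taylor_chi W Y a k)) ->
  GRing.comm z (polymap_eval (bigM F n r p0 q0) Y).
  move=> le_n zW.
  rewrite -[polymap_eval _ _]/(kw_eval r Y q0 (cpoly F n (p0 + q0))) cpoly_chi //.
  have [s ->] := kw_eval_taylor Y (@gl_quant_polynomial F n r) q0; last exact: minor_like_chi.
  elim/big_ind: _ => [|x y|[c [b k]] _]; first exact: commr0.
    exact: commrD.
  have [e ->] := iter_trder_chi F n (n - (p0 + q0)) b.
  rewrite /= (raddfMn (taylor W Y)) coefMn raddfMn /GRing.comm -scalerAr -scalerAl.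
  by congr (_ *: _); apply/commrMn/zW.
move=> le_n le_n'; apply: (bigME _ _ _ le_n') => a k.
apply/commr_sym; apply: (bigME _ _ _ le_n) => b l.
exact: taylor_chi_comm.
Qed.

Lemma big_algebra_comm (F : numFieldType) (n r : nat)
    (G H : 'M[F]_n -> endo (polyMat F n r)) :
  big_algebra G -> big_algebra H -> forall Y, GRing.comm (G Y) (H Y).
Proof.
move=> bG bH Y.
have comm_big (z : endo (polyMat F n r)) (K : 'M[F]_n -> endo (polyMat F n r)) :
    (forall p q, (p + q <= n)%N -> GRing.comm z (polymap_eval (bigM F n r p q) Y)) ->
    big_algebra K -> GRing.comm z (K Y).
  move=> zM; elim=> [p q /zM //||K1 K2 _ z1 _ z2|c K1 _ z1|K1 K2 _ z1 _ z2].
  - exact: commr1.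
  - exact: commrD.
  - by rewrite /GRing.comm /= -scalerAr -scalerAl z1.
  - exact: commrM.
apply: (comm_big _ _ _ bH) => p q le_n; apply/commr_sym.
apply: (comm_big _ _ _ bG) => p' q' le_n'.
exact: bigM_comm.
Qed.

Theorem theorem7p1 (R : realType) (n r : nat) (n_ge1 : (1 <= n)%N)
    (r_ge1 : (1 <= r)%N) (F G : 'M[R[i]%C]_n -> endo (polyMat R[i]%C n r)) :
  big_algebra F -> big_algebra G -> (F \* G)%R = (G \* F)%R.
Proof.
by move=> bF bG; apply: funext => Y; apply: big_algebra_comm.
Qed.
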